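(* Let $\langle\mathbf{A}_{\mathrm d},\mathbf{A},\iota\rangle$ be a distributively generated (generalized) additive quantale with multiplication. An $\mathbf{A}$-module $\mathbf{Q}$ is cyclic if and only if it is isomorphic to an $\mathbf{A}$-module of the form $\mathbf{A}_\gamma$ for some structural nucleus $\gamma$ on $\mathbf{A}$.
   Context: Fix one of two parallel settings: plain (''joins'' = joins of arbitrary families) or generalized (''joins'' = joins of non-empty families). A (generalized) quantale is $\langle Q,\bigvee,+,\mathsf{0}\rangle$ with $Q$ a poset having all such joins, $\langle Q,+,\mathsf{0}\rangle$ a monoid with $+$ order-preserving and distributing over such joins on both sides. A (generalized) additive quantale with multiplication is a triple $\langle\mathbf{A}_{\mathrm d},\mathbf{A},\iota\rangle$: $\mathbf{A}_{\mathrm d}$ a monoid, $\mathbf{A}$ a (generalized) quantale with an additional monoid structure $\langle A,\cdot,\mathsf 1\rangle$, $\iota$ a monoid homomorphism, such that $(\bigvee_i a_i)\cdot b=\bigvee_i(a_i\cdot b)$, $(a+b)\cdot c=a\cdot c+b\cdot c$, $\mathsf0\cdot a=\mathsf0$, and for $d\in\mathbf{A}_{\mathrm d}$ left multiplication by $\iota(d)$ preserves joins, $+$, $\mathsf0$; distributively generated means $\mathbf{A}$ is generated as a (generalized) quantale by $\iota[\mathbf{A}_{\mathrm d}]$. An $\mathbf{A}$-module is a (generalized) quantale $\mathbf{Q}$ with $\ast\colon A\times Q\to Q$, order-preserving in both coordinates, with $(a\cdot b)\ast x=a\ast(b\ast x)$, $\mathsf1\ast x=x$, $(a+b)\ast x=a\ast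 x+b\ast x$, $\mathsf0\ast x=\mathsf0$, $(\bigvee_i a_i)\ast x=\bigvee_i(a_i\ast x)$, and $x\mapsto\iota(d)\ast x$ preserving $+$, $\mathsf0$, joins for $d\in\mathbf{A}_{\mathrm d}$. $\mathbf{Q}$ is cyclic if $Q=\{a\ast u:a\in A\}$ for some $u\in Q$. $\mathbf{A}$ is an $\mathbf{A}$-module via $a\ast x=a\cdot x$. A structural nucleus on a module is an order-preserving, expansive, idempotent $\gamma$ with $\gamma(x)+\gamma(y)\le\gamma(x+y)$ and $a\ast\gamma(x)\le\gamma(a\ast x)$ for all $a\in A$. $\mathbf{A}_\gamma$ is the module on $\gamma[A]$ with $\bigvee_\gamma X=\gamma(\bigvee X)$, $x+_\gamma y=\gamma(x+y)$, $\mathsf0_\gamma=\gamma(\mathsf0)$, $a\ast_\gamma x=\gamma(a\cdot x)$. *)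

(* Defs.v *)
From HB Require Import structures.
From mathcomp Require Import all_boot all_order.
From mathcomp Require Import monoid boolp classical_sets.

Set Implicit Arguments.
Unset Strict Implicit.
Unset Printing Implicit Defensive.

Import Order.TTheory.
Local Open Scope classical_set_scope.
Local Open Scope group_scope.
Local Open Scope order_scope.

(* The two parallel settings: joins of arbitrary families, or joins of
   non-empty families only. *)
Variant setting := Plain | Generalized.

Definition joinable (s : setting) (T : Type) (X : set T) : Prop :=
  if s is Generalized then X !=set0 else True.

Declare Scope quantale_scope.
Delimit Scope quantale_scope with qt.
Local Open Scope quantale_scope.

Reserved Notation "a *: x" (at level 40).

(* [qjoin] is a total function, but it is only specified on [joinable] sets:
   its value at [set0] in the [Generalized] setting is irrelevant, and nothing
   below refers to it. *)
HB.mixin Record isQuantale (s : setting) (d : Order.disp_t) Q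
    of Order.POrder d Q := {
  qjoin : set Q -> Q;
  qadd : Q -> Q -> Q;
  qzero : Q;
  qjoinP : forall X : set Q, joinable s X -> supremums X (qjoin X);
  qaddA : associative qadd;
  qadd0l : left_id qzero qadd;
  qadd0r : right_id qzero qadd;
  le_qadd : forall x x' y y' : Q, x <= x' -> y <= y' -> qadd x y <= qadd x' y';
  qjoinDl : forall (X : set Q) (y : Q), joinable s X ->
    qadd (qjoin X) y = qjoin [set qadd x y | x in X];
  qjoinDr : forall (X : set Q) (y : Q), joinable s X ->
    qadd y (qjoin X) = qjoin [set qadd y x | x in X]
}.

#[short(type="quantaleType")]
HB.structure Definition Quantale (s : setting) (d : Order.disp_t) :=
  { Q of isQuantale s d Q & Order.POrder d Q }.

Arguments qjoin {s d Q} X : rename.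
Arguments qadd {s d Q} x y : rename.
Arguments qzero {s d Q} : rename.

Notation "x + y" := (qadd x y) : quantale_scope.
Notation "0" := qzero : quantale_scope.

Definition subquantale (s : setting) (d : Order.disp_t) (Q : quantaleType s d)
    (S : set Q) : Prop :=
  [/\ S 0,
      forall x y, S x -> S y -> S (x + y)
    & forall X : set Q, joinable s X -> X `<=` S -> S (qjoin X)].

(* The triple <Ad, A, iota>: the second monoid structure of A is that of
   [monoidType], and iota is part of the structure carried by A. *)
HB.mixin Record isAdditiveQuantale (Ad : monoidType) (s : setting)
    (d : Order.disp_t) A of Quantale s d A & Monoid A := {
  iota : Ad -> A;
  iota_morph : monoid_morphism iota;
  qjoinMl : forall (X : set A) (b : A), joinable s X ->
    qjoin X * b = qjoin [set a * b | a in X];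
  qaddMl : forall a b c : A, (a + b) * c = a * c + b * c;
  q0Ml : forall a : A, (0 : A) * a = 0;
  iotaM_join : forall (e : Ad) (X : set A), joinable s X ->
    iota e * qjoin X = qjoin [set iota e * x | x in X];
  iotaM_add : forall (e : Ad) (x y : A),
    iota e * (x + y) = iota e * x + iota e * y;
  iotaM_0 : forall e : Ad, iota e * (0 : A) = 0
}.

#[short(type="additiveQuantaleType")]
HB.structure Definition AdditiveQuantale (Ad : monoidType) (s : setting)
    (d : Order.disp_t) :=
  { A of isAdditiveQuantale Ad s d A & Quantale s d A & Monoid A }.

Arguments iota {Ad s d A} e : rename.

HB.mixin Record isDistrGenerated (Ad : monoidType) (s : setting)
    (d : Order.disp_t) A of AdditiveQuantale Ad s d A := {
  distr_generated :
    smallest (@subquantale s d A) (range (@iota Ad s d A)) = [set: A]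
}.

#[short(type="dgAdditiveQuantaleType")]
HB.structure Definition DGAdditiveQuantale (Ad : monoidType) (s : setting)
    (d : Order.disp_t) :=
  { A of isDistrGenerated Ad s d A & AdditiveQuantale Ad s d A }.

HB.mixin Record isModule (Ad : monoidType) (s : setting) (dA : Order.disp_t)
    (A : additiveQuantaleType Ad s dA) (d : Order.disp_t) Q
    of Quantale s d Q := {
  act : A -> Q -> Q;
  le_act : forall (a b : A) (x y : Q), a <= b -> x <= y -> act a x <= act b y;
  actM : forall (a b : A) (x : Q), act (a * b) x = act a (act b x);
  act1 : forall x : Q, act (1 : A) x = x;
  actDl : forall (a b : A) (x : Q), act (a + b) x = act a x + act b x;
  act0 : forall x : Q, act (0 : A) x = 0;
  act_joinl : forall (X : set A) (x : Q), joinable s X ->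
    act (qjoin X) x = qjoin [set act a x | a in X];
  act_iotaD : forall (e : Ad) (x y : Q),
    act (iota e) (x + y) = act (iota e) x + act (iota e) y;
  act_iota0 : forall e : Ad, act (iota e) (0 : Q) = 0;
  act_iota_join : forall (e : Ad) (X : set Q), joinable s X ->
    act (iota e) (qjoin X) = qjoin [set act (iota e) x | x in X]
}.

#[short(type="moduleType")]
HB.structure Definition Module (Ad : monoidType) (s : setting)
    (dA : Order.disp_t) (A : additiveQuantaleType Ad s dA)
    (d : Order.disp_t) :=
  { Q of isModule Ad s dA A d Q & Quantale s d Q }.

Arguments act {Ad s dA A d Q} a x : rename.

Notation "a *: x" := (act a x) : quantale_scope.

Definition cyclic (Ad : monoidType) (s : setting) (dA : Order.disp_t)
    (A : additiveQuantaleType Ad s dA) (d : Order.disp_t)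
    (Q : moduleType A d) : Prop :=
  exists u : Q, range (fun a : A => a *: u) = [set: Q].

Record module_iso (Ad : monoidType) (s : setting) (dA : Order.disp_t)
    (A : additiveQuantaleType Ad s dA) (d d' : Order.disp_t)
    (Q : moduleType A d) (Q' : moduleType A d') (f : Q -> Q') : Prop :=
  ModuleIso {
  module_iso_bij : bijective f;
  module_iso_le : {mono f : x y / x <= y};
  module_iso_join : forall X : set Q, joinable s X ->
    f (qjoin X) = qjoin (f @` X);
  module_iso_add : {morph f : x y / x + y};
  module_iso_zero : f 0 = 0;
  module_iso_act : forall (a : A) (x : Q), f (a *: x) = a *: f x
}.

Definition isomorphic (Ad : monoidType) (s : setting) (dA : Order.disp_t)
    (A : additiveQuantaleType Ad s dA) (d d' : Order.disp_t)
    (Q : moduleType A d) (Q' : moduleType A d') : Prop :=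
  exists f : Q -> Q', module_iso f.

Record structural_nucleus (Ad : monoidType) (s : setting) (dA : Order.disp_t)
    (A : additiveQuantaleType Ad s dA) (d : Order.disp_t)
    (Q : moduleType A d) := StructuralNucleus {
  nucleus :> Q -> Q;
  nucleus_le : {homo nucleus : x y / x <= y};
  nucleus_ge : forall x : Q, x <= nucleus x;
  nucleus_idem : forall x : Q, nucleus (nucleus x) = nucleus x;
  nucleus_add : forall x y : Q, nucleus x + nucleus y <= nucleus (x + y);
  nucleus_act : forall (a : A) (x : Q), a *: nucleus x <= nucleus (a *: x)
}.

Section QuantaleTheory.
Context (s : setting) (d : Order.disp_t) (Q : quantaleType s d).
Implicit Types (X Y : set Q) (x y : Q).

Lemma joinable_image (T U : Type) (f : T -> U) (X : set T) :
  joinable s X -> joinable s (f @` X).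
Proof. by case: s => //= -[x Xx]; exists (f x), x. Qed.

Lemma joinable2 (T : Type) (x y : T) : joinable s [set x; y].
Proof. by case: s => //=; exists x; left. Qed.

Lemma le_qjoin X x : joinable s X -> X x -> x <= qjoin X.
Proof. by move=> /qjoinP[ub _]; exact: ub. Qed.

Lemma qjoin_le X y : joinable s X -> (forall x, X x -> x <= y) -> qjoin X <= y.
Proof. by move=> /qjoinP[_ lb] Xy; exact: lb. Qed.

End QuantaleTheory.

(* The definition of an additive quantale with multiplication does not require
   a * x to be monotone in x for every a; this holds when A is distributively
   generated, which is what makes A a module over itself. *)
Section RegularModule.
Context (Ad : monoidType) (s : setting) (d : Order.disp_t).
Context (A : dgAdditiveQuantaleType Ad s d).

Lemma le_mulql (a b x : A) : a <= b -> a * x <= b * x.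
Proof.
move=> ab.
have jP := joinable2 s a b.
have <- : qjoin [set a; b] = b.
  apply/le_anti/andP; split; last by apply: le_qjoin => //; right.
  by apply: qjoin_le => // y [->|->].
rewrite qjoinMl//; apply: le_qjoin; first exact: joinable_image.
by exists a => //; left.
Qed.

Lemma le_mulqr (a x y : A) : x <= y -> a * x <= a * y.
Proof.
move=> xy.
have : smallest (@subquantale s d A) (range (@iota Ad s d A)) a.
  by rewrite distr_generated.
move/(_ [set b | b * x <= b * y]); apply; split; last first.
  move=> _ [e _ <-] /=.
  have jP := joinable2 s x y.
  have <- : qjoin [set x; y] = y.
    apply/le_anti/andP; split; last by apply: le_qjoin => //; right.
    by apply: qjoin_le => // z [->|->].
  rewrite iotaM_join//; apply: le_qjoin; first exact: joinable_image.
  by exists x => //; left.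
split => [|b c bxy cxy|X jX Xxy] /=.
- by rewrite !q0Ml.
- by rewrite !qaddMl; exact: le_qadd.
- rewrite !qjoinMl//; apply: qjoin_le; first exact: joinable_image.
  move=> _ [b Xb <-]; apply: (le_trans (Xxy b Xb)).
  by apply: le_qjoin; [exact: joinable_image|exists b].
Qed.

Lemma le_mulq (a b x y : A) : a <= b -> x <= y -> a * x <= b * y.
Proof. by move=> ab xy; exact: le_trans (le_mulql _ ab) (le_mulqr _ xy). Qed.

Definition regular_module : Type := A.

HB.instance Definition _ := Quantale.copy regular_module A.

HB.instance Definition _ :=
  isModule.Build Ad s d A d regular_module le_mulq
    (fun a b x => esym (mulgA a b x)) (@mul1g A) (@qaddMl Ad s d A)
    (@q0Ml Ad s d A) (@qjoinMl Ad s d A) (@iotaM_add Ad s d A)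
    (@iotaM_0 Ad s d A) (@iotaM_join Ad s d A).

End RegularModule.

Section NucleusImage.
Context (Ad : monoidType) (s : setting) (dA : Order.disp_t).
Context (A : additiveQuantaleType Ad s dA) (d : Order.disp_t).
Context (Q : moduleType A d) (g : structural_nucleus Q).

Definition nucleus_image : Type := set_type (range g).

HB.instance Definition _ := SubChoice.on nucleus_image.
HB.instance Definition _ :=
  [SubChoice_isSubPOrder of nucleus_image by <: with d].

Lemma le_nucleus_imageE (x y : nucleus_image) :
  (x <= y) = (val x <= val y :> Q).
Proof. by rewrite Order.le_val. Qed.

Lemma nucleus_in (x : Q) : g x \in range g.
Proof. by apply/mem_set; exists x. Qed.

Definition nucleus_proj (x : Q) : nucleus_image := SigSub (nucleus_in x).

Definition nucleus_join (X : set nucleus_image) : nucleus_image :=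
  nucleus_proj (qjoin [set val x | x in X]).
Definition nucleus_plus (x y : nucleus_image) : nucleus_image :=
  nucleus_proj (val x + val y).
Definition nucleus_zero : nucleus_image := nucleus_proj 0.
Definition nucleus_scale (a : A) (x : nucleus_image) : nucleus_image :=
  nucleus_proj (a *: val x).

Lemma nucleus_fix (x : nucleus_image) : g (val x) = val x.
Proof. by case: x => x /= /set_mem[y _ <-]; rewrite nucleus_idem. Qed.

Lemma nucleus_lel (x y : Q) : x <= g y -> g x <= g y.
Proof. by move=> /(nucleus_le g); rewrite nucleus_idem. Qed.

Lemma nucleus_addE (x y : Q) : g (g x + g y) = g (x + y).
Proof.
apply/le_anti/andP; split; first exact/nucleus_lel/nucleus_add.
by apply: nucleus_le; apply: le_qadd; exact: nucleus_ge.
Qed.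

Lemma nucleus_actE (a : A) (x : Q) : g (a *: g x) = g (a *: x).
Proof.
apply/le_anti/andP; split; first exact/nucleus_lel/nucleus_act.
by apply: nucleus_le; apply: le_act => //; exact: nucleus_ge.
Qed.

Lemma nucleus_joinE (X : set Q) : joinable s X ->
  g (qjoin (g @` X)) = g (qjoin X).
Proof.
move=> jX; have jgX := joinable_image g jX.
apply/le_anti/andP; split; apply: nucleus_lel; apply: qjoin_le => //.
  by move=> _ [x Xx <-]; apply: nucleus_le; exact: le_qjoin.
move=> x Xx; apply: le_trans (nucleus_ge g _).
by apply: le_trans (nucleus_ge g x) _; apply: le_qjoin => //; exists x.
Qed.

Lemma nucleus_joinP (X : set nucleus_image) : joinable s X ->
  supremums X (nucleus_join X).
Proof.
move=> jX; have jvX := joinable_image (val : nucleus_image -> Q) jX.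
split=> [x Xx|y Xy] /=; rewrite le_nucleus_imageE.
  by apply: le_trans (nucleus_ge g _); apply: le_qjoin => //; exists x.
rewrite -(nucleus_fix y); apply: nucleus_lel; rewrite nucleus_fix.
by apply: qjoin_le => // _ [x Xx <-]; rewrite -le_nucleus_imageE; exact: Xy.
Qed.

Lemma nucleus_plusA : associative nucleus_plus.
Proof.
move=> x y z; apply: val_inj => /=.
rewrite -[in LHS](nucleus_fix x) -[in RHS](nucleus_fix z).
by rewrite !nucleus_addE qaddA.
Qed.

Lemma nucleus_plus0l : left_id nucleus_zero nucleus_plus.
Proof.
move=> x; apply: val_inj => /=.
by rewrite -[in LHS](nucleus_fix x) nucleus_addE qadd0l nucleus_fix.
Qed.

Lemma nucleus_plus0r : right_id nucleus_zero nucleus_plus.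
Proof.
move=> x; apply: val_inj => /=.
by rewrite -[in LHS](nucleus_fix x) nucleus_addE qadd0r nucleus_fix.
Qed.

Lemma le_nucleus_plus (x x' y y' : nucleus_image) :
  x <= x' -> y <= y' -> nucleus_plus x y <= nucleus_plus x' y'.
Proof.
rewrite !le_nucleus_imageE => xx' yy'.
by apply: nucleus_le; exact: le_qadd.
Qed.

Lemma nucleus_joinDl (X : set nucleus_image) (y : nucleus_image) :
  joinable s X -> nucleus_plus (nucleus_join X) y =
                  nucleus_join [set nucleus_plus x y | x in X].
Proof.
move=> jX; have jvX := joinable_image (val : nucleus_image -> Q) jX.
apply: val_inj => /=.
rewrite -[in LHS](nucleus_fix y) nucleus_addE qjoinDl//.
rewrite -[LHS]nucleus_joinE; last exact: joinable_image.
by rewrite !image_comp.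
Qed.

Lemma nucleus_joinDr (X : set nucleus_image) (y : nucleus_image) :
  joinable s X -> nucleus_plus y (nucleus_join X) =
                  nucleus_join [set nucleus_plus y x | x in X].
Proof.
move=> jX; have jvX := joinable_image (val : nucleus_image -> Q) jX.
apply: val_inj => /=.
rewrite -[in LHS](nucleus_fix y) nucleus_addE qjoinDr//.
rewrite -[LHS]nucleus_joinE; last exact: joinable_image.
by rewrite !image_comp.
Qed.

HB.instance Definition _ :=
  isQuantale.Build s d nucleus_image nucleus_joinP nucleus_plusA
    nucleus_plus0l nucleus_plus0r le_nucleus_plus nucleus_joinDl nucleus_joinDr.

Lemma le_nucleus_scale (a b : A) (x y : nucleus_image) :
  a <= b -> x <= y -> nucleus_scale a x <= nucleus_scale b y.
Proof.
rewrite !le_nucleus_imageE => ab xy.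
by apply: nucleus_le; exact: le_act.
Qed.

Lemma nucleus_scaleM (a b : A) (x : nucleus_image) :
  nucleus_scale (a * b) x = nucleus_scale a (nucleus_scale b x).
Proof. by apply: val_inj; rewrite /= nucleus_actE actM. Qed.

Lemma nucleus_scale1 (x : nucleus_image) : nucleus_scale 1 x = x.
Proof. by apply: val_inj; rewrite /= act1 nucleus_fix. Qed.

Lemma nucleus_scaleDl (a b : A) (x : nucleus_image) :
  nucleus_scale (a + b) x = nucleus_scale a x + nucleus_scale b x.
Proof. by apply: val_inj; rewrite /= nucleus_addE actDl. Qed.

Lemma nucleus_scale0 (x : nucleus_image) : nucleus_scale 0 x = 0.
Proof. by apply: val_inj; rewrite /= act0. Qed.

Lemma nucleus_scale_joinl (X : set A) (x : nucleus_image) : joinable s X ->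
  nucleus_scale (qjoin X) x = qjoin [set nucleus_scale a x | a in X].
Proof.
move=> jX; apply: val_inj => /=.
rewrite act_joinl// -[LHS]nucleus_joinE; last exact: joinable_image.
by rewrite !image_comp.
Qed.

Lemma nucleus_scale_iotaD (e : Ad) (x y : nucleus_image) :
  nucleus_scale (iota e) (x + y) =
  nucleus_scale (iota e) x + nucleus_scale (iota e) y.
Proof.
by apply: val_inj; rewrite /= nucleus_addE nucleus_actE act_iotaD.
Qed.

Lemma nucleus_scale_iota0 (e : Ad) :
  nucleus_scale (iota e) (0 : nucleus_image) = 0.
Proof. by apply: val_inj; rewrite /= nucleus_actE act_iota0. Qed.

Lemma nucleus_scale_iota_join (e : Ad) (X : set nucleus_image) :
  joinable s X -> nucleus_scale (iota e) (qjoin X) =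
                  qjoin [set nucleus_scale (iota e) x | x in X].
Proof.
move=> jX; have jvX := joinable_image (val : nucleus_image -> Q) jX.
apply: val_inj => /=.
rewrite nucleus_actE act_iota_join// -[LHS]nucleus_joinE;
  last exact: joinable_image.
by rewrite !image_comp.
Qed.

HB.instance Definition _ :=
  isModule.Build Ad s dA A d nucleus_image le_nucleus_scale nucleus_scaleM
    nucleus_scale1 nucleus_scaleDl nucleus_scale0 nucleus_scale_joinl
    nucleus_scale_iotaD nucleus_scale_iota0 nucleus_scale_iota_join.

End NucleusImage.

(* Main.v *)
Require Import Defs.
From mathcomp Require Import all_boot all_order.
From mathcomp Require Import monoid boolp classical_sets.

(** Cyclic modules are exactly the images of the regular module, a generator
    [u] corresponding to the surjection [a |-> a *: u].  Moreover every
    surjective morphism [f : M -> Q] preserves joins, hence has an upper adjoint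
    [h], with [f \o h = id]; then [h \o f] is a structural nucleus on [M], whose
    fixed points [f] maps isomorphically onto [Q]. *)

Set Implicit Arguments.
Unset Strict Implicit.
Unset Printing Implicit Defensive.

Import Order.TTheory.
Local Open Scope classical_set_scope.
Local Open Scope group_scope.
Local Open Scope order_scope.
Local Open Scope quantale_scope.

Lemma nonempty_joinable (s : setting) (T : Type) (X : set T) :
  X !=set0 -> joinable s X.
Proof. by case: s. Qed.

Lemma qjoin2_idPr (s : setting) (d : Order.disp_t) (Q : quantaleType s d)
    (x y : Q) : reflect (qjoin [set x; y] = y) (x <= y).
Proof.
have xyj := joinable2 s x y; apply: (iffP idP) => [xy|<-].
  apply/le_anti/andP; split; last by apply: le_qjoin => //; right.
  by apply: qjoin_le => // _ [->|->].
by apply: le_qjoin => //; left.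
Qed.

Record module_morphism (Ad : monoidType) (s : setting) (dA : Order.disp_t)
    (A : additiveQuantaleType Ad s dA) (d d' : Order.disp_t)
    (M : moduleType A d) (Q : moduleType A d') (f : M -> Q) : Prop :=
  ModuleMorphism {
  module_morphism_join : forall X : set M, joinable s X ->
    f (qjoin X) = qjoin (f @` X);
  module_morphism_add : {morph f : x y / x + y};
  module_morphism_zero : f 0 = 0;
  module_morphism_act : forall (a : A) (x : M), f (a *: x) = a *: f x
}.

Definition morphic_image (Ad : monoidType) (s : setting) (dA : Order.disp_t)
    (A : additiveQuantaleType Ad s dA) (d d' : Order.disp_t)
    (M : moduleType A d) (Q : moduleType A d') : Prop :=
  exists2 f : M -> Q, module_morphism f & range f = [set: Q].

Section ModuleMorphism.
Context (Ad : monoidType) (s : setting) (dA : Order.disp_t).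
Context (A : additiveQuantaleType Ad s dA).

Lemma module_morphism_le (d d' : Order.disp_t) (M : moduleType A d)
    (Q : moduleType A d') (f : M -> Q) :
  module_morphism f -> {homo f : x y / x <= y}.
Proof.
move=> fM x y /qjoin2_idPr xy; apply/qjoin2_idPr.
by rewrite -[in RHS]xy module_morphism_join ?image_setU ?image_set1//;
  exact: joinable2.
Qed.

Lemma module_morphism_comp (d1 d2 d3 : Order.disp_t) (M : moduleType A d1)
    (N : moduleType A d2) (Q : moduleType A d3) (f : M -> N) (g : N -> Q) :
  module_morphism f -> module_morphism g -> module_morphism (g \o f).
Proof.
move=> fM gM; split=> [X jX|x y||a x] /=.
- by rewrite !module_morphism_join// ?image_comp//; exact: joinable_image.
- by rewrite !module_morphism_add.
- by rewrite !module_morphism_zero.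
- by rewrite !module_morphism_act.
Qed.

Lemma module_iso_morphism (d d' : Order.disp_t) (M : moduleType A d)
    (Q : moduleType A d') (f : M -> Q) : module_iso f -> module_morphism f.
Proof. by case. Qed.

Lemma isomorphic_sym (d d' : Order.disp_t) (M : moduleType A d)
    (Q : moduleType A d') : isomorphic M Q -> isomorphic Q M.
Proof.
move=> [f [[h fK hK] f_le f_join f_add f_zero f_act]]; exists h; split.
- by exists f.
- by move=> x y; rewrite -f_le !hK.
- move=> X jX; apply: (can_inj fK); rewrite hK f_join ?image_comp.
    by rewrite (eq_imagel (f' := id)) ?image_id// => x _; exact: hK.
  exact: joinable_image.
- by move=> x y; apply: (can_inj fK); rewrite f_add !hK.
- by apply: (can_inj fK); rewrite f_zero hK.
- by move=> a x; apply: (can_inj fK); rewrite f_act !hK.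
Qed.

Lemma nucleus_proj_morphism (d : Order.disp_t) (M : moduleType A d)
    (g : structural_nucleus M) : module_morphism (nucleus_proj g).
Proof.
split=> [X jX|x y||a x]; apply: val_inj => //=.
- by rewrite -nucleus_joinE// image_comp.
- by rewrite nucleus_addE.
- by rewrite nucleus_actE.
Qed.

Lemma nucleus_proj_val (d : Order.disp_t) (M : moduleType A d)
    (g : structural_nucleus M) : cancel val (nucleus_proj g).
Proof. by move=> x; apply: val_inj; exact: nucleus_fix. Qed.

End ModuleMorphism.

Section UpperAdjoint.
Context (Ad : monoidType) (s : setting) (dA : Order.disp_t).
Context (A : additiveQuantaleType Ad s dA) (d d' : Order.disp_t).
Context (M : moduleType A d) (Q : moduleType A d') (f : M -> Q).
Hypotheses (f_morph : module_morphism f) (f_surj : range f = [set: Q]).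
Implicit Types (a b : M) (x : Q).

Definition upper_adjoint x : M := qjoin [set a | f a <= x].

(* Surjectivity makes the join exist in the generalized setting too. *)
Lemma joinable_upper_adjoint x : joinable s [set a | f a <= x].
Proof.
have [a _ fa] : range f x by rewrite f_surj.
by apply: nonempty_joinable; exists a; rewrite /= fa.
Qed.

Lemma morphism_upper_adjoint_le x : f (upper_adjoint x) <= x.
Proof.
have jx := joinable_upper_adjoint x.
rewrite (module_morphism_join f_morph)//; apply: qjoin_le.
  exact: joinable_image.
by move=> _ [a ax <-].
Qed.

Lemma le_upper_adjoint a x : (a <= upper_adjoint x) = (f a <= x).
Proof.
apply/idP/idP => [ax|fax].
  exact/(le_trans _ (morphism_upper_adjoint_le x))/module_morphism_le.
by apply: le_qjoin => //; exact: joinable_upper_adjoint.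
Qed.

Lemma upper_adjointK : cancel upper_adjoint f.
Proof.
move=> x; apply/le_anti; rewrite morphism_upper_adjoint_le/=.
have [a _ <-] : range f x by rewrite f_surj.
by apply: module_morphism_le => //; rewrite le_upper_adjoint.
Qed.

Definition kernel_closure a : M := upper_adjoint (f a).

Lemma le_kernel_closure a b : (a <= kernel_closure b) = (f a <= f b).
Proof. exact: le_upper_adjoint. Qed.

Lemma morphism_kernel_closure a : f (kernel_closure a) = f a.
Proof. exact: upper_adjointK. Qed.

Lemma kernel_closure_homo : {homo kernel_closure : a b / a <= b}.
Proof.
move=> a b ab; rewrite le_kernel_closure morphism_kernel_closure.
exact: module_morphism_le.
Qed.

Lemma kernel_closure_ge a : a <= kernel_closure a.
Proof. by rewrite le_kernel_closure. Qed.

Lemma kernel_closure_idem a :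
  kernel_closure (kernel_closure a) = kernel_closure a.
Proof. by rewrite /kernel_closure upper_adjointK. Qed.

Lemma kernel_closure_add a b :
  kernel_closure a + kernel_closure b <= kernel_closure (a + b).
Proof.
rewrite le_kernel_closure !(module_morphism_add f_morph).
by rewrite !morphism_kernel_closure.
Qed.

Lemma kernel_closure_act (c : A) a :
  c *: kernel_closure a <= kernel_closure (c *: a).
Proof.
rewrite le_kernel_closure !(module_morphism_act f_morph).
by rewrite morphism_kernel_closure.
Qed.

Definition kernel_nucleus : structural_nucleus M :=
  StructuralNucleus kernel_closure_homo kernel_closure_ge kernel_closure_idem
    kernel_closure_add kernel_closure_act.

Lemma kernel_nucleus_val_morphism :
  module_morphism (fun a : nucleus_image kernel_nucleus => f (val a)).
Proof.
split=> [X jX|a b||c a]; rewrite [LHS]morphism_kernel_closure.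
- rewrite (module_morphism_join f_morph) ?image_comp//.
  exact: joinable_image.
- exact: module_morphism_add.
- exact: module_morphism_zero.
- exact: module_morphism_act.
Qed.

Lemma kernel_nucleus_val_iso :
  module_iso (fun a : nucleus_image kernel_nucleus => f (val a)).
Proof.
have [val_join val_add val_zero val_act] := kernel_nucleus_val_morphism.
split=> // [|a b].
  exists (fun x => nucleus_proj kernel_nucleus (upper_adjoint x)) => [a|x].
    rewrite -[RHS]nucleus_proj_val; apply: val_inj.
    exact: kernel_closure_idem.
  by rewrite morphism_kernel_closure upper_adjointK.
by rewrite le_nucleus_imageE -[in RHS](nucleus_fix b) le_kernel_closure.
Qed.

End UpperAdjoint.

Lemma morphic_imageP (Ad : monoidType) (s : setting) (dA : Order.disp_t)
    (A : additiveQuantaleType Ad s dA) (d d' : Order.disp_t)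
    (M : moduleType A d) (Q : moduleType A d') :
  morphic_image M Q <->
  exists g : structural_nucleus M, isomorphic Q (nucleus_image g).
Proof.
split=> [[f f_morph f_surj]|[g /isomorphic_sym[h h_iso]]].
  exists (kernel_nucleus f_morph f_surj).
  by apply: isomorphic_sym; eexists; exact: kernel_nucleus_val_iso.
exists (h \o nucleus_proj g).
  apply: module_morphism_comp (nucleus_proj_morphism g) _.
  exact: module_iso_morphism.
have [k _ kK] := module_iso_bij h_iso.
apply/seteqP; split=> // x _; exists (val (k x)) => //=.
by rewrite nucleus_proj_val kK.
Qed.

Section CyclicModule.
Context (Ad : monoidType) (s : setting) (dA : Order.disp_t).
Context (A : dgAdditiveQuantaleType Ad s dA).
Context (d : Order.disp_t) (Q : moduleType A d).

Lemma act_morphism (u : Q) :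
  module_morphism (fun a : regular_module A => (a : A) *: u).
Proof.
split=> [X jX|a b||b a].
- exact: act_joinl.
- exact: (actDl a b u).
- exact: act0.
- exact: (actM b a u).
Qed.

Lemma regular_morphismE (f : regular_module A -> Q) (a : A) :
  module_morphism f -> f a = a *: f (1 : A).
Proof.
move=> f_morph; rewrite -(module_morphism_act f_morph).
by congr f; rewrite [RHS]mulg1.
Qed.

Lemma cyclicP : cyclic Q <-> morphic_image (regular_module A) Q.
Proof.
split=> [[u u_gen]|[f f_morph f_surj]].
  by exists (fun a => (a : A) *: u); [exact: act_morphism|].
exists (f (1 : A)); rewrite -f_surj; apply: eq_imagel => a _.
by rewrite -regular_morphismE.
Qed.

End CyclicModule.

Theorem theorem6p7 (s : setting) (Ad : monoidType) (dA : Order.disp_t)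
    (A : dgAdditiveQuantaleType Ad s dA)
    (dQ : Order.disp_t) (Q : moduleType A dQ) :
  cyclic Q <->
  exists g : structural_nucleus (regular_module A),
    isomorphic Q (nucleus_image g).
Proof. exact: iff_trans (cyclicP Q) (morphic_imageP (regular_module A) Q). Qed.
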